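(* Let $X\in\mathbb{R}^{n\times p}$ be a column-centered matrix ($1_n^\top X=0_p^\top$), let $\widehat S_n=\frac1nX^\top X$, and let $q$ be a positive integer with $n>q$. For every $\Gamma\in\mathbb{R}^{p\times q}$, $$\min_{Z}\ \frac1n\left\|X-Z\Gamma^\top\right\|_F^2 = d_{\mathrm{BW}}^2\left(\widehat S_n,\Gamma\Gamma^\top\right),$$ where the minimum is over all $Z\in\mathbb{R}^{n\times q}$ with $\frac1nZ^\top Z=I_q$ and $1_n^\top Z=0_q^\top$. In particular (principal component analysis), for a positive integer $m<n$ and every $\Lambda\in\mathbb{R}^{p\times m}$, $$\min_{F}\ \frac1n\left\|X-F\Lambda^\top\right\|_F^2 = d_{\mathrm{BW}}^2\left(\widehat S_n,\Lambda\Lambda^\top\right),$$ where the minimum is over all $F\in\mathbb{R}^{n\times m}$ with $\frac1nF^\top F=I_m$ and $1_n^\top F=0_m^\top$.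
   Context: Here $1_n$ is the vector of ones in $\mathbb{R}^n$ and $0_q$ is the zero vector in $\mathbb{R}^q$. For a positive semidefinite matrix $A$, $A^{1/2}$ is its positive semidefinite square root. For positive semidefinite $p\times p$ matrices $A,B$, the Bures-Wasserstein distance $d_{\mathrm{BW}}(A,B)\ge 0$ is given by $d_{\mathrm{BW}}^2(A,B)=\mathrm{tr}(A)+\mathrm{tr}(B)-2\,\mathrm{tr}\{(A^{1/2}BA^{1/2})^{1/2}\}$. *)

(* Defs.v *)
From mathcomp Require Import all_boot all_order all_algebra.
From mathcomp Require Import boolp classical_sets reals.

Set Implicit Arguments.
Unset Strict Implicit.
Unset Printing Implicit Defensive.

Import Order.TTheory GRing.Theory Num.Theory.
Local Open Scope classical_set_scope.
Local Open Scope ring_scope.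

Definition psd (R : realType) (p : nat) (A : 'M[R]_p) : Prop :=
  A^T = A /\ forall v : 'cV[R]_p, 0 <= (v^T *m A *m v) 0 0.

(* A positive semidefinite matrix has exactly one positive semidefinite square
   root, so the choice made by [xget] is forced when [A] is positive
   semidefinite; the default value 0 is only taken for other matrices. *)
Definition sqrtmx (R : realType) (p : nat) (A : 'M[R]_p) : 'M[R]_p :=
  xget 0 [set S : 'M[R]_p | psd S /\ S *m S = A].

(* The argument of [Num.sqrt] is nonnegative for positive semidefinite [A] and
   [B], so there the square of [bwdist A B] is this argument. *)
Definition bwdist (R : realType) (p : nat) (A B : 'M[R]_p) : R :=
  Num.sqrt (\tr A + \tr B - 2 * \tr (sqrtmx (sqrtmx A *m B *m sqrtmx A))).

(* The norm that MathComp-Analysis puts on matrices is the sup norm. *)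
Definition frobnorm (R : realType) (m n : nat) (A : 'M[R]_(m, n)) : R :=
  Num.sqrt (\sum_(i < m) \sum_(j < n) A i j ^+ 2).

Definition ones (R : realType) (n : nat) : 'cV[R]_n := const_mx 1.

Definition colcentered (R : realType) (n p : nat) (X : 'M[R]_(n, p)) : Prop :=
  (ones R n)^T *m X = (0 : 'cV[R]_p)^T.

Definition samplecov (R : realType) (n p : nat) (X : 'M[R]_(n, p)) : 'M[R]_p :=
  n%:R^-1 *: (X^T *m X).

(* Attained minimum, as opposed to [inf]. *)
Definition is_minimum (R : realType) (E : set R) (m : R) : Prop :=
  E m /\ lbound E m.

(* Main.v *)
Require Import Defs.
From mathcomp Require Import all_boot all_order all_algebra.
From mathcomp Require Import boolp classical_sets reals.
From mathcomp Require Import complex lra.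

Set Implicit Arguments.
Unset Strict Implicit.
Unset Printing Implicit Defensive.

Import Order.TTheory GRing.Theory Num.Theory.
Local Open Scope classical_set_scope.
Local Open Scope ring_scope.

(* Expanding the Frobenius norm turns the problem into maximising the trace of
   G^T X^T Z. Diagonalise G^T S G = Q^T diag(s)^2 Q with S the sample covariance.
   The rows of W = Q G^T X^T are then orthogonal of norms sqrt(n) s, and orthogonal
   to the vector of ones, so that W = sqrt(n) diag(s) N with N having orthonormal
   rows that are also orthogonal to the ones; such an N exists as q < n. Hence the
   trace is at most n times the sum of s, with equality at Z = sqrt(n) N^T Q.
   Finally the sum of s is the trace of the root of Y Y^T for Y = S^(1/2) G, since
   Y^T Y = G^T S G and Y Y^T have the same nonzero eigenvalues. *)

(** * Real eigenvalues, orthonormal rows and the spectral theorem *)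

Lemma mul_trmx_ge0 (R : rcfType) (m n : nat) (A : 'M[R]_(m, n)) i :
  0 <= (A *m A^T) i i.
Proof. by rewrite mxE sumr_ge0 // => j _; rewrite mxE -expr2 sqr_ge0. Qed.

Lemma mul_trmx_eq0 (R : rcfType) (m n : nat) (A : 'M[R]_(m, n)) :
  \tr (A *m A^T) = 0 -> A = 0.
Proof.
move=> /eqP; rewrite /mxtrace psumr_eq0; last by move=> i _; exact: mul_trmx_ge0.
move=> /allP A0; apply/matrixP => i j.
have := A0 i (mem_index_enum i); rewrite /= mxE psumr_eq0; last first.
  by move=> k _; rewrite mxE -expr2 sqr_ge0.
move=> /allP /(_ j (mem_index_enum j)); rewrite !mxE -expr2 sqrf_eq0.
by move=> /eqP.
Qed.

(** Over [R[i]] there is a left eigenvector [v] for some [c]. Its conjugate [w] gives a right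
    eigenvector for the conjugate of [c], so evaluating [v *m B *m w^T] both ways forces [c] to be
    real. A real root of the complexified characteristic polynomial is a root of the original
    one. *)
Lemma symmetric_eigenvalue (R : rcfType) (n : nat) (A : 'M[R]_n.+1) :
  A^T = A -> exists a, eigenvalue A a.
Proof.
move=> symA; pose B := map_mx (real_complex R) A.
have [c Bc] := eigenvalue_closed B (ltn0Sn n).
have /eigenvalueP[v vB v0] := Bc.
pose w := map_mx (conjc : R[i] -> R[i]) v.
have Bconj : map_mx (conjc : R[i] -> R[i]) B = B.
  by apply/matrixP => i j; rewrite !mxE; apply/eqP; rewrite eq_complex /= oppr0 !eqxx.
have wB : w *m B = (conjc c : R[i]) *: w.
  by rewrite -{1}Bconj /w -map_mxM vB map_mxZ.
have Bw : B *m w^T = (conjc c : R[i]) *: w^T.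
  have BT : B^T = B by rewrite /B map_trmx symA.
  by rewrite -{1}BT -trmx_mul wB linearZ.
have vw0 : (v *m w^T) 0 0 != 0.
  rewrite mxE (eq_bigr (fun j => `|v 0 j| ^+ 2)); last first.
    by move=> j _; rewrite !mxE normCK.
  rewrite psumr_eq0; last by move=> j _; rewrite exprn_ge0.
  apply: contraNN v0 => /allP v0; apply/eqP/rowP => j.
  have := v0 j (mem_index_enum j).
  by rewrite /= sqrf_eq0 normr_eq0 !mxE => /eqP.
have ccb : c = conjc c.
  have : v *m B *m w^T = v *m (B *m w^T) by rewrite mulmxA.
  rewrite vB Bw -scalemxAl -scalemxAr => /matrixP /(_ 0 0).
  by rewrite mxE [RHS]mxE => /(mulIf vw0).
have cr : c = (complex.Re c)%:C%C.
  by move: ccb; case: (c) => a b [] /eqP; rewrite -addr_eq0 -mulr2n mulrn_eq0 => /eqP ->.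
exists (complex.Re c); rewrite eigenvalue_root_char.
rewrite -(fmorph_root (real_complex R)) map_char_poly -eigenvalue_root_char.
by move: Bc; rewrite {1}cr.
Qed.

Lemma normalize_row (R : rcfType) (n : nat) (v : 'rV[R]_n) : v != 0 ->
  exists c : R, (c *: v) *m (c *: v)^T = 1%:M.
Proof.
move=> v0.
have vv : 0 < (v *m v^T) 0 0.
  rewrite lt0r mul_trmx_ge0 andbT; apply: contraNneq v0 => vv0.
  by apply/eqP/mul_trmx_eq0; rewrite /mxtrace big_ord1.
exists ((Num.sqrt ((v *m v^T) 0 0))^-1).
rewrite linearZ /= -scalemxAl -scalemxAr scalerA {3}[v *m v^T]mx11_scalar.
rewrite scale_scalar_mx -invfM -expr2 sqr_sqrtr ?ltW //.
by rewrite mulVf // gt_eqF.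
Qed.

Lemma unit_row_orthogonal (R : rcfType) (m n : nat) (B : 'M[R]_(m, n)) :
  (m < n)%N -> exists2 u : 'rV[R]_n, u *m u^T = 1%:M & u *m B^T = 0.
Proof.
move=> mn; have : kermx B^T != 0.
  rewrite -mxrank_eq0 mxrank_ker -lt0n subn_gt0.
  by apply: leq_ltn_trans mn; exact: rank_leq_col.
move=> /rowV0Pn[v /sub_kermxP vB /normalize_row[c cv]].
by exists (c *: v) => //; rewrite -scalemxAl vB scaler0.
Qed.

(* Induction on [k]: when [s 0 0 <> 0] the first row of [N] is forced, and it joins
   [B] before the induction; otherwise it is any unit vector orthogonal to [B] and
   to the rows already built. *)
Lemma orthonormal_factor (R : rcfType) (m k n : nat) (B : 'M[R]_(m, n))
    (W : 'M[R]_(k, n)) (s : 'rV[R]_k) :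
    (m + k <= n)%N -> W *m W^T = diag_mx (map_mx (fun x => x ^+ 2) s) ->
    W *m B^T = 0 ->
  exists N : 'M[R]_(k, n),
    [/\ N *m N^T = 1%:M, N *m B^T = 0 & W = diag_mx s *m N].
Proof.
elim: k m B W s => [|k IHk] m B W s mkn.
  by move=> _ _; exists 0; split; apply/matrixP; case.
rewrite -[k.+1]/(1 + k)%N in W s *.
rewrite -(vsubmxK W) -(hsubmxK s).
move: (usubmx W) (dsubmx W) (lsubmx s) (rsubmx s) => w {}W a {}s.
rewrite map_row_mx diag_mx_row tr_col_mx mul_col_row.
move=> /eq_block_mx[ww wW Ww WW].
rewrite mul_col_mx -col_mx0 => /eq_col_mx[wB WB].
have [a0|a0] := eqVneq (a 0 0) 0.
  have w0 : w = 0.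
    by apply: mul_trmx_eq0; rewrite ww mxtrace_diag big_ord1 !mxE a0 expr0n.
  have [N [NN NB ->]] := IHk m B W s (leq_trans (leq_add (leqnn m) (leqnSn k)) mkn) WW WB.
  (* Here [m + k < n], so there is room for one more unit vector orthogonal to [B] and [N]. *)
  have [|u uu] := @unit_row_orthogonal R (m + k) n (col_mx B N).
    by rewrite -addnS.
  rewrite tr_col_mx mul_mx_row -row_mx0 => /eq_row_mx[uB uN].
  have Nu : N *m u^T = 0 by rewrite -[N]trmxK -trmx_mul uN trmx0.
  exists (col_mx u N); split.
  - by rewrite tr_col_mx mul_col_row uu NN uN Nu -scalar_mx_block.
  - by rewrite mul_col_mx uB NB col_mx0.
  rewrite diag_mx_row mul_block_col !mul0mx add0r addr0 w0; congr col_mx.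
  by rewrite [a]mx11_scalar a0 raddf0 linear0 mul0mx.
have [||N [NN]] := IHk _ (col_mx B w) W s _ WW.
- by rewrite addn1 addSn -addnS.
- by rewrite tr_col_mx mul_mx_row WB Ww row_mx0.
rewrite tr_col_mx mul_mx_row -row_mx0 => /eq_row_mx[NB Nw] ->.
have aD : diag_mx a = (a 0 0)%:M by apply/matrixP=> i j; rewrite !mxE !ord1.
exists (col_mx ((a 0 0)^-1 *: w) N); split.
- rewrite tr_col_mx mul_col_row NN [in RHS]scalar_mx_block linearZ /=.
  rewrite -!scalemxAl -!scalemxAr Nw -[w *m N^T]trmxK trmx_mul trmxK Nw trmx0.
  rewrite !scaler0 ww scalerA.
  suff -> : (a 0 0)^-1 / a 0 0 *: diag_mx (map_mx (fun x => x ^+ 2) a) = 1%:M by [].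
  by apply/matrixP=> i j; rewrite !mxE !ord1 /= !mulr1n expr2 -invfM mulVf ?mulf_neq0.
- by rewrite mul_col_mx -scalemxAl wB NB scaler0 col_mx0.
rewrite diag_mx_row mul_block_col !mul0mx add0r addr0 aD mul_scalar_mx scalerA.
by rewrite divff // scale1r.
Qed.

(** Deflation: split off a unit eigenvector [u], then diagonalise the compression of [A] to the
    orthogonal complement of [u]. *)
Lemma symmetric_spectral (R : rcfType) (n : nat) (A : 'M[R]_n) : A^T = A ->
  exists Q : 'M[R]_n, exists d : 'rV[R]_n,
    Q *m Q^T = 1%:M /\ Q *m A *m Q^T = diag_mx d.
Proof.
elim: n A => [|n IHn] A symA.
  by exists 0, 0; split; apply/matrixP; case.
have [a /eigenvalueP[v vA /normalize_row[c]]] := symmetric_eigenvalue symA.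
set u := c *: v => uu.
have uA : u *m A = a *: u by rewrite -scalemxAl vA !scalerA mulrC.
(* With [W] and [s] zero, the factorisation serves as basis completion: the rows of [C] extend [u]
   to an orthonormal basis. *)
have [||C [CC Cu _]] := @orthonormal_factor R 1 n n.+1 u 0 0 (leqnn _).
- by rewrite mul0mx; apply/matrixP => i j; rewrite !mxE expr0n mul0rn.
- by rewrite mul0mx.
have uC : u *m C^T = 0 by rewrite -[u]trmxK -trmx_mul Cu trmx0.
have [|Q [d [QQ Qd]]] := IHn (C *m A *m C^T).
  by rewrite !trmx_mul trmxK symA mulmxA.
clear vA.
rewrite -[n.+1]/(1 + n)%N in v A symA u uA uu C CC Cu uC QQ Qd *.
exists (col_mx u (Q *m C)), (row_mx (a%:M : 'M_1) d); split.
  rewrite tr_col_mx mul_col_row uu trmx_mul !mulmxA uC mul0mx -(mulmxA Q) Cu.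
  by rewrite mulmx0 -(mulmxA Q) CC mulmx1 QQ -scalar_mx_block.
(* By symmetry [u^T] is also a right eigenvector, so both off-diagonal blocks vanish. *)
have Au : A *m u^T = a *: u^T by rewrite -[A]symA -trmx_mul uA linearZ.
rewrite -mulmxA tr_col_mx mul_mx_row mul_col_row Au -!scalemxAr uu trmx_mul.
rewrite (mulmxA u) uA -scalemxAl (mulmxA u) uC mul0mx -(mulmxA Q C u^T) Cu mulmx0.
have -> : Q *m C *m (A *m (C^T *m Q^T)) = diag_mx d by rewrite -Qd !mulmxA.
rewrite !scaler0 diag_mx_row.
by congr block_mx; apply/matrixP=> i j; rewrite !mxE !ord1 mulr_natr.
Qed.

(** * Positive semidefinite matrices and their square roots *)

Lemma gramZ (R : comPzRingType) (m n : nat) (c : R) (A : 'M[R]_(m, n)) :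
  (c *: A)^T *m (c *: A) = c ^+ 2 *: (A^T *m A).
Proof. by rewrite -scalemxAr [(c *: A)^T]linearZ -scalemxAl scalerA expr2. Qed.

Lemma psd_congr (R : realType) (m n : nat) (A : 'M[R]_m) (B : 'M[R]_(m, n)) :
  psd A -> psd (B^T *m A *m B).
Proof.
move=> [symA A0]; split; first by rewrite !trmx_mul trmxK symA mulmxA.
by move=> v; have := A0 (B *m v); rewrite trmx_mul !mulmxA.
Qed.

Lemma psd_diag (R : realType) (n : nat) (s : 'rV[R]_n) :
  (forall i, 0 <= s 0 i) -> psd (diag_mx s).
Proof.
move=> s0; split=> [|v]; first by rewrite tr_diag_mx.
rewrite mul_mx_diag mxE sumr_ge0 // => j _; rewrite !mxE mulrAC.
by rewrite mulr_ge0 // -expr2 sqr_ge0.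
Qed.

Lemma psd_gram (R : realType) (m n : nat) (B : 'M[R]_(m, n)) : psd (B^T *m B).
Proof.
split=> [|v]; first by rewrite trmx_mul trmxK.
have := mul_trmx_ge0 (v^T *m B^T) 0.
by rewrite trmx_mul !trmxK !mulmxA.
Qed.

Lemma psd_spectral (R : realType) (n : nat) (A : 'M[R]_n) : psd A ->
  exists Q : 'M[R]_n, exists s : 'rV[R]_n,
    [/\ Q *m Q^T = 1%:M, forall i, 0 <= s 0 i &
        Q *m A *m Q^T = diag_mx (map_mx (fun x => x ^+ 2) s)].
Proof.
move=> psdA; have [Q [d [QQ Qd]]] := symmetric_spectral (proj1 psdA).
have d0 i : 0 <= d 0 i.
  (* Each eigenvalue is the quadratic form of the diagonalised matrix at a basis vector. *)
  have := psd_congr Q^T psdA; rewrite trmxK Qd => -[_ /(_ (delta_mx i 0))].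
  by rewrite trmx_delta -rowE -colE !mxE eqxx mulr1n.
exists Q, (map_mx Num.sqrt d); split => // [i|]; first by rewrite mxE sqrtr_ge0.
by rewrite Qd; congr diag_mx; apply/rowP => i; rewrite !mxE sqr_sqrtr.
Qed.

Lemma diag_mx_sqr (R : pzRingType) (n : nat) (s : 'rV[R]_n) :
  diag_mx s *m diag_mx s = diag_mx (map_mx (fun x => x ^+ 2) s).
Proof. by rewrite mulmx_diag; congr diag_mx; apply/rowP => i; rewrite !mxE. Qed.

Lemma psd_sqrt_ex (R : realType) (n : nat) (A : 'M[R]_n) : psd A ->
  exists2 S : 'M[R]_n, psd S & S *m S = A.
Proof.
move=> /psd_spectral[Q [s [QQ s0 QA]]].
exists (Q^T *m diag_mx s *m Q); first exact/psd_congr/psd_diag.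
have QTQ := mulmx1C QQ.
rewrite -!mulmxA (mulmxA Q) QQ mul1mx (mulmxA _ _ Q) diag_mx_sqr -QA.
by rewrite -!mulmxA QTQ mulmx1 mulmxA QTQ mul1mx.
Qed.

(* With [D = A - B], [D A + B D = 0] makes the traces of [D A D] and [D B D],
   both nonnegative, cancel each other. *)
Lemma psd_sqrt_unique (R : realType) (n : nat) (A B : 'M[R]_n) :
  psd A -> psd B -> A *m A = B *m B -> A = B.
Proof.
move=> psdA psdB AB; pose D := A - B.
have symD : D^T = D by rewrite linearB /= (proj1 psdA) (proj1 psdB).
(* Roots of [A] and [B] themselves turn the two traces into squared norms of [D *m S] and [D *m T],
   which therefore vanish. *)
have [S [symS _] SA] := psd_sqrt_ex psdA.
have [T [symT _] TB] := psd_sqrt_ex psdB.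
have trS (U : 'M[R]_n) : U^T = U ->
    \tr ((D *m U) *m (D *m U)^T) = \tr (D *m (U *m U) *m D).
  by move=> symU; rewrite trmx_mul symU symD !mulmxA.
have tr0 : \tr (D *m (S *m S) *m D) + \tr (D *m (T *m T) *m D) = 0.
  rewrite SA TB mxtrace_mulC -(mulmxA D B D) -mxtraceD -mulmxDr.
  have -> : D *m A + B *m D = 0 by rewrite mulmxBl mulmxBr AB addrA subrK subrr.
  by rewrite mulmx0 mxtrace0.
move/eqP: tr0; rewrite -(trS S symS) -(trS T symT) paddr_eq0; first last.
- by rewrite /mxtrace sumr_ge0 // => i _; exact: mul_trmx_ge0.
- by rewrite /mxtrace sumr_ge0 // => i _; exact: mul_trmx_ge0.
move=> /andP[/eqP/mul_trmx_eq0 DS /eqP/mul_trmx_eq0 DT].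
apply/eqP; rewrite -subr_eq0; apply/eqP/mul_trmx_eq0.
rewrite -/D symD {2}/D mulmxBr -SA -TB !mulmxA DS DT.
by rewrite !mul0mx subr0 mxtrace0.
Qed.

Lemma sqrtmxP (R : realType) (n : nat) (A : 'M[R]_n) : psd A ->
  psd (sqrtmx A) /\ sqrtmx A *m sqrtmx A = A.
Proof.
move=> /psd_sqrt_ex[S psdS SA].
exact: (@xgetPex _ 0 [set S | psd S /\ S *m S = A] (ex_intro _ S (conj psdS SA))).
Qed.

(* With [W := Q Y^T], whose rows are orthogonal of norms [s], the root of
   [Y Y^T] is [W^T diag(1/s) W]; since [0^-1 = 0], the zero rows drop out. *)
Lemma mxtrace_sqrtmx (R : realType) (p q : nat) (Y : 'M[R]_(p, q))
    (Q : 'M[R]_q) (s : 'rV[R]_q) :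
    Q *m Q^T = 1%:M -> (forall i, 0 <= s 0 i) ->
    Q *m (Y^T *m Y) *m Q^T = diag_mx (map_mx (fun x => x ^+ 2) s) ->
  \tr (sqrtmx (Y *m Y^T)) = \sum_i s 0 i.
Proof.
move=> QQ s0 QY; pose W := Q *m Y^T.
have WW : W *m W^T = diag_mx s *m diag_mx s.
  by rewrite diag_mx_sqr -QY trmx_mul trmxK !mulmxA.
have WTW : W^T *m W = Y *m Y^T.
  by rewrite trmx_mul trmxK -mulmxA (mulmxA Q^T) (mulmx1C QQ) mul1mx.
clearbody W.
pose t : 'rV[R]_q := map_mx (fun x => x^-1) s.
(* The product of the two diagonal matrices has a 0 wherever [s] does, but there the row of [W] has
   norm 0. *)
have tssW : diag_mx t *m diag_mx s *m W = W.
  apply/row_matrixP => i; apply/rowP => j.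
  rewrite mulmx_diag mul_diag_mx !mxE.
  have [si0|si0] := eqVneq (s 0 i) 0; last by rewrite mulVf ?mul1r.
  suff /rowP/(_ j) : row i W = 0 by rewrite !mxE => ->; rewrite mulr0.
  apply: mul_trmx_eq0; rewrite /mxtrace big_ord1 tr_row.
  have -> : (row i W *m col i W^T) 0 0 = (W *m W^T) i i.
    by rewrite !mxE; apply: eq_bigr => k _; rewrite !mxE.
  by rewrite WW mulmx_diag !mxE si0 mul0r mul0rn.
have psdYY : psd (Y *m Y^T) by have := psd_gram Y^T; rewrite trmxK.
have [psdK KK] := sqrtmxP psdYY.
have -> : sqrtmx (Y *m Y^T) = W^T *m diag_mx t *m W.
  apply: psd_sqrt_unique => //.
    by apply/psd_congr/psd_diag => i; rewrite mxE invr_ge0.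
  rewrite KK -WTW -{2}tssW.
  rewrite -!mulmxA (mulmxA W) WW.
  rewrite -(mulmxA (diag_mx s)) (mulmxA (diag_mx s) (diag_mx t)).
  by rewrite (diag_mxC s t) tssW.
rewrite -mulmxA mxtrace_mulC -mulmxA WW mulmxA mulmx_diag mulmx_diag.
rewrite mxtrace_diag; apply: eq_bigr => i _; rewrite !mxE.
by have [->|si0] := eqVneq (s 0 i) 0; rewrite ?mulr0 // mulVf ?mul1r.
Qed.

(** * The Frobenius residual and its minimum *)

Lemma frobnorm_sqr (R : realType) (m n : nat) (A : 'M[R]_(m, n)) :
  frobnorm A ^+ 2 = \tr (A^T *m A).
Proof.
rewrite mxtrace_mulC sqr_sqrtr; last first.
  by apply: sumr_ge0 => i _; apply: sumr_ge0 => j _; exact: sqr_ge0.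
by apply: eq_bigr => i _; rewrite mxE; apply: eq_bigr => j _; rewrite mxE.
Qed.

(** The normalisation of [Z] makes the quadratic term of the expansion constant, and the two cross
    terms are transposes of each other; only one trace still depends on [Z]. *)
Lemma mean_residual (R : realType) (n p q : nat) (X : 'M[R]_(n, p))
    (Z : 'M[R]_(n, q)) (G : 'M[R]_(p, q)) :
  n%:R^-1 *: (Z^T *m Z) = 1%:M ->
  n%:R^-1 * frobnorm (X - Z *m G^T) ^+ 2 =
    \tr (samplecov X) + \tr (G *m G^T)
      - 2 * (n%:R^-1 * \tr (G^T *m X^T *m Z)).
Proof.
move=> ZZ; rewrite frobnorm_sqr.
have -> : (X - Z *m G^T)^T = X^T - G *m Z^T by rewrite linearB /= trmx_mul trmxK.
rewrite mulmxBl !mulmxBr !linearB /= !mulrBr.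
have -> : n%:R^-1 * \tr (G *m Z^T *m (Z *m G^T)) = \tr (G *m G^T).
  by rewrite -mxtraceZ mulmxA -(mulmxA G) scalemxAl scalemxAr ZZ mulmx1.
have -> : \tr (X^T *m (Z *m G^T)) = \tr (G^T *m X^T *m Z).
  by rewrite mulmxA mxtrace_mulC mulmxA.
have -> : \tr (G *m Z^T *m X) = \tr (G^T *m X^T *m Z).
  by rewrite -[LHS]mxtrace_tr !trmx_mul trmxK mulmxA mxtrace_mulC mulmxA.
rewrite /samplecov mxtraceZ opprB addrACA -opprD; congr (_ + _).
by rewrite mulr_natl mulr2n.
Qed.

Lemma samplecov_psd (R : realType) (n p : nat) (X : 'M[R]_(n, p)) :
  psd (samplecov X).
Proof.
have -> : samplecov X = (Num.sqrt n%:R^-1 *: X)^T *m (Num.sqrt n%:R^-1 *: X).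
  by rewrite gramZ sqr_sqrtr // invr_ge0 ler0n.
exact: psd_gram.
Qed.

(** Cauchy-Schwarz for the [i]-th rows, of norms 1 and [r]: expand the squared norm of their
    difference after scaling the first by [r], then divide by [2 * r]. *)
Lemma diag_mul_trmx_le (R : rcfType) (k n : nat) (N V : 'M[R]_(k, n)) (r : R) i :
  0 < r -> N *m N^T = 1%:M -> V *m V^T = (r ^+ 2)%:M -> (N *m V^T) i i <= r.
Proof.
move=> r0 NN VV; have := mul_trmx_ge0 (r *: N - V) i.
have -> : (r *: N - V)^T = r *: N^T - V^T by rewrite linearB /= linearZ.
have VN : (V *m N^T) i i = (N *m V^T) i i by rewrite -[V in LHS]trmxK -trmx_mul mxE.
rewrite mulmxBl !mulmxBr -!scalemxAl -!scalemxAr NN VV.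
move: (N *m V^T) (V *m N^T) VN => a b ba.
rewrite !mxE ba eqxx /= mulr1n => le0; rewrite -(ler_pM2l r0); lra.
Qed.

Lemma bwdist_minimum (R : realType) (n p q : nat) (X : 'M[R]_(n, p))
    (G : 'M[R]_(p, q)) :
  colcentered X -> (q < n)%N ->
  is_minimum
    [set n%:R^-1 * frobnorm (X - Z *m G^T) ^+ 2
      | Z in [set Z : 'M[R]_(n, q)
               | n%:R^-1 *: (Z^T *m Z) = 1%:M /\ colcentered Z]]
    (bwdist (samplecov X) (G *m G^T) ^+ 2).
Proof.
move=> hX qn.
have n0 : (n%:R : R) != 0 by rewrite pnatr_eq0 -lt0n (leq_trans _ qn).
pose r : R := Num.sqrt n%:R.
have rr : r * r = n%:R by rewrite -expr2 sqr_sqrtr ?ler0n.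
have r0 : 0 < r by rewrite sqrtr_gt0 lt0r n0 ler0n.
have [psdT TT] := sqrtmxP (samplecov_psd X).
set T := sqrtmx (samplecov X) in psdT TT.
pose Y := T *m G.
have YTY : Y^T *m Y = G^T *m samplecov X *m G.
  by rewrite /Y trmx_mul (proj1 psdT) -TT !mulmxA.
have YYT : Y *m Y^T = T *m (G *m G^T) *m T.
  by rewrite /Y trmx_mul (proj1 psdT) !mulmxA.
have [Q [s [QQ s0 QY]]] := psd_spectral (psd_gram Y).
have trK := mxtrace_sqrtmx QQ s0 QY.
have QTQ := mulmx1C QQ.
pose W := Q *m G^T *m X^T.
have WW : W *m W^T = diag_mx (map_mx (fun x => x ^+ 2) (r *: s)).
  have -> : map_mx (fun x => x ^+ 2) (r *: s) =
      n%:R *: map_mx (fun x => x ^+ 2) s.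
    by apply/rowP => i; rewrite !mxE exprMn expr2 rr.
  rewrite linearZ /= -QY YTY /samplecov -!scalemxAr -!scalemxAl -scalemxAr.
  by rewrite -scalemxAl scalerA divff // scale1r !trmx_mul !trmxK !mulmxA.
have W1 : W *m ((ones R n)^T)^T = 0.
  by rewrite trmxK -mulmxA -[ones R n]trmxK -trmx_mul hX trmxK mulmx0.
(* The row of ones plays the part of [B], so [q < n] is exactly the dimension bound [1 + q <= n]. *)
have [|N [NN N1 WN]] := orthonormal_factor _ WW W1; first by rewrite add1n.
have trW (Z : 'M[R]_(n, q)) :
    \tr (G^T *m X^T *m Z) = \sum_i r * s 0 i * (N *m (Q *m Z^T)^T) i i.
  have -> : G^T *m X^T *m Z = Q^T *m (W *m Z).
    by rewrite /W !mulmxA QTQ mul1mx.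
  rewrite mxtrace_mulC WN -!mulmxA trmx_mul trmxK /mxtrace.
  by apply: eq_bigr => i _; rewrite mul_diag_mx !mxE.
have bound (Z : 'M[R]_(n, q)) : n%:R^-1 *: (Z^T *m Z) = 1%:M ->
    n%:R^-1 * \tr (G^T *m X^T *m Z) <= \sum_i s 0 i.
  move=> ZZ; rewrite trW ler_pdivrMl ?lt0r ?n0 ?ler0n // mulr_sumr.
  apply: ler_sum => i _; rewrite -rr -mulrA -mulrA (ler_wpM2l (ltW r0)) // mulrC.
  rewrite ler_wpM2r // diag_mul_trmx_le //.
  (* It remains to see that the rows of [Q *m Z^T] are orthogonal of norm [r]. *)
  rewrite trmx_mul trmxK mulmxA -(mulmxA Q) expr2 rr.
  have -> : Z^T *m Z = n%:R%:M.
    by rewrite -[LHS]scale1r -[X in X *: _](divff n0) -scalerA ZZ scale_scalar_mx mulr1.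
  by rewrite mul_mx_scalar -scalemxAl QQ scale_scalar_mx mulr1.
(* Chosen so that [Q *m Z0^T = r *: N], the equality case of Cauchy-Schwarz in every row. *)
pose Z0 := r *: (N^T *m Q).
have ZZ0 : n%:R^-1 *: (Z0^T *m Z0) = 1%:M.
  rewrite gramZ expr2 rr scalerA mulVf // scale1r.
  by rewrite trmx_mul trmxK mulmxA -(mulmxA _ N) NN mulmx1.
have cZ0 : colcentered Z0.
  rewrite /colcentered trmx0 -scalemxAr mulmxA.
  by rewrite -[X in X *m _]trmxK trmx_mul trmxK N1 trmx0 mul0mx scaler0.
have trZ0 : n%:R^-1 * \tr (G^T *m X^T *m Z0) = \sum_i s 0 i.
  rewrite trW mulr_sumr; apply: eq_bigr => i _.
  have -> : (Q *m Z0^T)^T = r *: N^T.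
    by rewrite trmx_mul trmxK -scalemxAl -mulmxA QQ mulmx1.
  rewrite -scalemxAr NN !mxE eqxx mulr1 (mulrC r) -mulrA rr.
  by rewrite mulrC mulfK.
have bwE : bwdist (samplecov X) (G *m G^T) ^+ 2 =
    \tr (samplecov X) + \tr (G *m G^T) - 2 * \sum_i s 0 i.
  (* The argument of [Num.sqrt] is nonnegative because it equals the mean residual at [Z0]. *)
  rewrite /bwdist -/T -YYT trK sqr_sqrtr // -trZ0 -mean_residual //.
  by rewrite mulr_ge0 ?invr_ge0 ?ler0n ?sqr_ge0.
rewrite bwE; split.
  by exists Z0 => //=; rewrite mean_residual // trZ0.
move=> _ [Z [ZZ _] <-]; rewrite mean_residual // lerD2l lerN2 ler_wpM2l //.
exact: bound.
Qed.

Theorem mainTheorem2 (R : realType) (n p : nat) (X : 'M[R]_(n, p))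
    (hX : colcentered X) :
  (forall (q : nat) (hq : (0 < q)%N) (hqn : (q < n)%N) (Gamma : 'M[R]_(p, q)),
    is_minimum
      [set n%:R^-1 * frobnorm (X - Z *m Gamma^T) ^+ 2
        | Z in [set Z : 'M[R]_(n, q)
                 | n%:R^-1 *: (Z^T *m Z) = 1%:M /\ colcentered Z]]
      (bwdist (samplecov X) (Gamma *m Gamma^T) ^+ 2))
  /\
  (forall (m : nat) (hm : (0 < m)%N) (hmn : (m < n)%N) (Lambda : 'M[R]_(p, m)),
    is_minimum
      [set n%:R^-1 * frobnorm (X - F *m Lambda^T) ^+ 2
        | F in [set F : 'M[R]_(n, m)
                 | n%:R^-1 *: (F^T *m F) = 1%:M /\ colcentered F]]
      (bwdist (samplecov X) (Lambda *m Lambda^T) ^+ 2)).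
Proof.
by split=> q _ hqn G; exact: bwdist_minimum.
Qed.
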